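(* Let $a>0$ and $c\in\mathbb{R}$. (1) For $0<x<y$, the inequality $$\frac{(\Gamma(x+a))^{1/x}}{(\Gamma(y+a))^{1/y}}>\left(\frac{x+a}{y+a}\right)^c$$ holds if $a\ge 2$ and $c\ge 1$; and the reversed inequality (with $<$) holds if $a=2$ and $c\le\frac{\pi^2}{6}-1$. (2) For $x,y>0$, the inequalities $$\left(\frac xy\right)^{\frac{y\psi(y+a)-\log\Gamma(y+a)}{y}-\frac{cy}{y+a}}\left(\frac{x+a}{y+a}\right)^c\le\frac{(\Gamma(x+a))^{1/x}}{(\Gamma(y+a))^{1/y}}\le\left(\frac xy\right)^{\frac{x\psi(x+a)-\log\Gamma(x+a)}{x}-\frac{cx}{x+a}}\left(\frac{x+a}{y+a}\right)^c$$ hold if $c\le 0$ and either $\frac12\le a\le 1$ or $a\ge 2$. In each of these inequalities, equality holds if and only if $x=y$.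
   Context: $\Gamma$ is the gamma function on $(0,\infty)$ and $\psi=\Gamma'/\Gamma$ is the digamma function. *)

(* Defs.v *)
From Stdlib Require Import Reals.
From Coquelicot Require Import Coquelicot.
Open Scope R_scope.

(** Euler's integral of the second kind, improper at both ends; it converges
    exactly for [0 < x], and only the values there are meaningful.  Since
    [t > 0] along the integration, [Rpower t (x - 1)] is the genuine power. *)
Definition Gamma (x : R) : R :=
  RInt_gen (fun t : R => Rpower t (x - 1) * exp (- t))
           (at_right 0) (Rbar_locally p_infty).

Definition digamma (x : R) : R := Derive Gamma x / Gamma x.

(* Main.v *)
Require Import Defs.
From Stdlib Require Import Reals Lra Lia Psatz.
From Coquelicot Require Import Coquelicot.
Open Scope R_scope.

(** Write [t = x + a] and [log_root a c x = ln (Gamma t) / x - c * ln t].  After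
    taking logarithms, part (1) says that [log_root] is strictly monotone, and
    part (2) says that it is strictly convex as a function of [ln x]: the lower
    and upper bounds are the tangent-line inequalities at [y] and at [x].  So
    the sign of [log_root'] is needed for (1), and the monotonicity of
    [x * log_root'] for (2).

    The derivatives of [ln Gamma] come from Gauss's product.  Euler's integral is
    log-convex (Young's inequality under the integral, [ln_Gamma_convex]) and
    satisfies [Gamma (x + 1) = x * Gamma x], so the Bohr-Mollerup argument
    ([bohr_mollerup]) writes [ln Gamma] as an explicit series of elementary
    functions.  Differentiating it term by term ([is_derive_series]) identifies
    [psi], [psi'] and [psi''] with series, and comparing these with telescoping
    ones ([telescope_lt_series], [series_lt_telescope]) gives, for [t > 0],

      [1 / t + 1 / (2 t^2) < psi' t < 1 / t + 1 / t^2]   and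
      [- psi'' t < 1 / t^2 + 1 / t^3 + 1 / (2 t^4)].

    For (1), [x^2 * log_root' x] takes the value [- ln (Gamma a)] at [0] and has
    the derivative [x * (psi' t - c * (t + a) / t^2)].  When [2 <= a] and
    [1 <= c], the first is nonpositive and the second is negative by the upper
    bound on [psi'].  When [a = 2], the first is zero, and
    [t^2 * psi' t - c * (t + 2)] increases from its value [4 * (psi' 2 - c)] at
    [t = 2].  This is nonnegative because [PI^2 / 6 - 1 <= psi' 2]
    ([trigamma_2_ge]), half of Euler's evaluation of [zeta 2]; it follows from the
    duplication formula for [psi'] by Herglotz's trick.

    For (2), since [c <= 0], it is enough that
    [x^2 * psi' t - x * psi t + ln (Gamma t)] be positive.  Its value at [0] is
    [ln (Gamma a)], nonnegative for [a <= 1] and for [2 <= a] because [ln Gamma]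
    is convex and vanishes at [1] and [2].  Its derivative is
    [x * (psi' t + x * psi'' t)], and here [x <= t - 1/2]: with [t - 1/2] in
    place of [x], the two bounds above cancel up to a remainder of the right
    sign. *)

(** * Euler's integral *)

(** A nonnegative integrand with bounded truncated integrals has an improper
    integral, namely their supremum.  The characterization as a supremum
    is what later transfers inequalities between truncated integrals to
    [Gamma]. *)
Lemma is_RInt_gen_of_bounded (f : R -> R) (C : R)
  (hc : forall t, 0 < t -> continuous f t)
  (hp : forall t, 0 < t -> 0 <= f t)
  (hb : forall a b, 0 < a -> a <= b -> RInt f a b <= C) :
  exists l,
    is_RInt_gen f (at_right 0) (Rbar_locally p_infty) l /\
    (forall a b, 0 < a -> a <= b -> RInt f a b <= l) /\
    (forall M, (forall a b, 0 < a -> a <= b -> RInt f a b <= M) -> l <= M).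
Proof.
  assert (ei : forall a b, 0 < a -> a <= b -> ex_RInt f a b).
  { intros a b Ha Hab. apply (@ex_RInt_continuous R_CompleteNormedModule).
    intros z Hz. rewrite Rmin_left in Hz by lra. apply hc; lra. }
  destruct (completeness
    (fun v => exists a b, 0 < a /\ a <= b /\ v = RInt f a b)) as [l [Hub Hlub]].
  - exists C. intros v (a & b & Ha & Hab & ->). now apply hb.
  - exists (RInt f 1 1), 1, 1. repeat split; lra.
  - assert (U : forall a b, 0 < a -> a <= b -> RInt f a b <= l).
    { intros a b Ha Hab. apply Hub. now exists a, b. }
    assert (L : forall M,
      (forall a b, 0 < a -> a <= b -> RInt f a b <= M) -> l <= M).
    { intros M HM. apply Hlub. intros v (a & b & Ha & Hab & ->). now apply HM. }
    exists l. split; [|split; assumption].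
    intros P [eps HP].
    destruct (Classical_Prop.classic
      (exists a b, 0 < a /\ a <= b /\ l - eps < RInt f a b))
      as [(a & b & Ha & Hab & Hl) | Hn].
    2:{ assert (l <= l - eps).
        { apply L. intros a b Ha Hab. apply Rnot_lt_le. intro Hlt.
          apply Hn. now exists a, b. }
        destruct eps; simpl in *; lra. }
    apply Filter_prod with (fun a' => 0 < a' < a) (fun b' => b < b').
    + exists (mkposreal a Ha). intros y Hy Hy0. split; [exact Hy0|].
      apply Rabs_lt_between' in Hy. simpl in Hy. lra.
    + exists b. tauto.
    + intros a' b' [Ha1 Ha2] Hb. simpl.
      exists (RInt f a' b'). split.
      * apply (@RInt_correct R_CompleteNormedModule). apply ei; lra.
      * apply HP. apply Rabs_lt_between'.
        assert (RInt f a' b' <= l) by (apply U; lra).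
        assert (E : RInt f a' b' = RInt f a' a + (RInt f a b + RInt f b b')).
        { rewrite <- (RInt_Chasles f a' a b') by (apply ei; lra).
          rewrite <- (RInt_Chasles f a b b') by (apply ei; lra). reflexivity. }
        assert (0 <= RInt f a' a).
        { apply RInt_ge_0; [lra | apply ei; lra | intros; apply hp; lra]. }
        assert (0 <= RInt f b b').
        { apply RInt_ge_0; [lra | apply ei; lra | intros; apply hp; lra]. }
        destruct eps; simpl in *; lra.
Qed.

Definition gamma_integrand (x t : R) : R := Rpower t (x - 1) * exp (- t).

(** The boundary term of the integration by parts behind
    [Gamma (x + 1) = x * Gamma x]. *)
Definition gamma_boundary (x t : R) : R := Rpower t x * exp (- t).

Lemma gamma_integrand_pos x t : 0 < gamma_integrand x t.
Proof. apply Rmult_lt_0_compat; apply exp_pos. Qed.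

Lemma gamma_boundary_pos x t : 0 < gamma_boundary x t.
Proof. apply Rmult_lt_0_compat; apply exp_pos. Qed.

Lemma continuous_gamma_integrand x t : 0 < t -> continuous (gamma_integrand x) t.
Proof.
  intros Ht. apply (ex_derive_continuous (gamma_integrand x)).
  unfold gamma_integrand, Rpower. auto_derive. exact Ht.
Qed.

Lemma ex_RInt_gamma_integrand x a b :
  0 < a -> a <= b -> ex_RInt (gamma_integrand x) a b.
Proof.
  intros Ha Hab. apply (@ex_RInt_continuous R_CompleteNormedModule).
  intros z Hz. rewrite Rmin_left in Hz by lra.
  apply continuous_gamma_integrand; lra.
Qed.

Lemma gamma_integrand_succ x t :
  0 < t -> gamma_integrand (x + 1) t = t * gamma_integrand x t.
Proof.
  intros Ht. unfold gamma_integrand.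
  replace (x + 1 - 1) with (1 + (x - 1)) by ring.
  rewrite Rpower_plus, Rpower_1 by lra. ring.
Qed.

Lemma is_derive_gamma_boundary x t : 0 < t ->
  is_derive (gamma_boundary x) t (x * gamma_integrand x t - gamma_integrand (x + 1) t).
Proof.
  intros Ht. rewrite gamma_integrand_succ by assumption.
  unfold gamma_boundary, gamma_integrand.
  replace (Rpower t (x - 1)) with (Rpower t x / t).
  2:{ unfold Rminus. rewrite Rpower_plus, Rpower_Ropp, Rpower_1 by lra.
      reflexivity. }
  unfold Rpower. auto_derive; [exact Ht | field; lra].
Qed.

Lemma exp_le_compat u v : u <= v -> exp u <= exp v.
Proof.
  intros [H | ->]; [left; now apply exp_increasing | apply Rle_refl].
Qed.

Lemma ln_le_sub_1 u : 0 < u -> ln u <= u - 1.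
Proof.
  intros Hu. generalize (exp_ineq1_le (ln u)). rewrite exp_ln by assumption. lra.
Qed.

(** The maximum of [t ^ x * exp (- t)] over [t > 0] is attained at [t = x]; the
    factor [exp (- x)] of the maximal value is dropped. *)
Lemma gamma_boundary_le x t :
  0 < x -> 0 < t -> gamma_boundary x t <= exp (x * ln x).
Proof.
  intros Hx Ht. unfold gamma_boundary, Rpower. rewrite <- exp_plus.
  destruct (Req_dec (x * ln t + - t) (x * ln x)) as [-> | Hne]; [lra|].
  left. apply exp_increasing.
  assert (Htx : 0 < t / x) by now apply Rdiv_lt_0_compat.
  generalize (ln_le_sub_1 _ Htx). rewrite ln_div by assumption. intros H.
  assert (x * (ln t - ln x) <= x * (t / x - 1)) by (apply Rmult_le_compat_l; lra).
  replace (x * (t / x - 1)) with (t - x) in H0 by (field; lra). lra.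
Qed.

Lemma RInt_gamma_integrand_succ x a b : 0 < a -> a <= b ->
  x * RInt (gamma_integrand x) a b - RInt (gamma_integrand (x + 1)) a b
  = gamma_boundary x b - gamma_boundary x a.
Proof.
  intros Ha Hab.
  assert (H : is_RInt (fun t => x * gamma_integrand x t - gamma_integrand (x + 1) t)
                a b (gamma_boundary x b - gamma_boundary x a)).
  { apply (is_RInt_derive (gamma_boundary x)); intros t Ht;
      rewrite Rmin_left in Ht by lra.
    - apply is_derive_gamma_boundary; lra.
    - apply (continuous_minus (fun t => x * gamma_integrand x t)).
      + apply (continuous_scal_r x (gamma_integrand x)), continuous_gamma_integrand; lra.
      + apply continuous_gamma_integrand; lra. }
  apply (is_RInt_unique (V := R_CompleteNormedModule)) in H. rewrite <- H. symmetry.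
  rewrite (RInt_minus (fun t => x * gamma_integrand x t)).
  - rewrite (RInt_scal (gamma_integrand x)) by now apply ex_RInt_gamma_integrand.
    reflexivity.
  - apply (ex_RInt_scal (gamma_integrand x)). now apply ex_RInt_gamma_integrand.
  - now apply ex_RInt_gamma_integrand.
Qed.

Definition gamma_bounded (x : R) : Prop :=
  exists C, forall a b, 0 < a -> a <= b -> RInt (gamma_integrand x) a b <= C.

Lemma gamma_bounded_1 : gamma_bounded 1.
Proof.
  exists 1. intros a b Ha Hab.
  assert (H : is_RInt (gamma_integrand 1) a b (- exp (- b) - - exp (- a))).
  { apply (is_RInt_derive (fun t => - exp (- t))); intros t Ht;
      rewrite Rmin_left in Ht by lra.
    - unfold gamma_integrand. rewrite Rminus_diag, Rpower_O by lra.
      auto_derive; [easy | ring].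
    - apply continuous_gamma_integrand; lra. }
  apply (is_RInt_unique (V := R_CompleteNormedModule)) in H. rewrite H.
  generalize (exp_pos (- b)); intros.
  assert (exp (- a) < exp 0) by (apply exp_increasing; lra).
  rewrite exp_0 in *. lra.
Qed.

(** Integration by parts compares the truncated integrals for [x] and [x + 1]
    up to a bounded boundary term.  Hence boundedness climbs from [1] to all
    positive integers, and descends from [1 <= x] to [0 < x]. *)
Lemma gamma_bounded_succ x : 0 < x -> (gamma_bounded x <-> gamma_bounded (x + 1)).
Proof.
  intros Hx. split; intros [C HC].
  - exists (x * C + exp (x * ln x)). intros a b Ha Hab.
    generalize (RInt_gamma_integrand_succ x a b Ha Hab); intros E.
    generalize (gamma_boundary_le x a Hx Ha) (gamma_boundary_pos x b); intros.
    assert (x * RInt (gamma_integrand x) a b <= x * C)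
      by (apply Rmult_le_compat_l; [lra | now apply HC]).
    lra.
  - exists (/ x * (C + exp (x * ln x))). intros a b Ha Hab.
    generalize (RInt_gamma_integrand_succ x a b Ha Hab); intros E.
    assert (Hb : 0 < b) by lra.
    generalize (gamma_boundary_le x b Hx Hb) (gamma_boundary_pos x a) (HC a b Ha Hab); intros.
    apply Rmult_le_reg_l with x; [lra|].
    replace (x * (/ x * (C + exp (x * ln x)))) with (C + exp (x * ln x))
      by (field; lra).
    lra.
Qed.

Lemma gamma_bounded_INR n : gamma_bounded (INR n + 1).
Proof.
  induction n as [|n IH].
  - simpl. rewrite Rplus_0_l. apply gamma_bounded_1.
  - rewrite S_INR. apply (gamma_bounded_succ (INR n + 1)); [|exact IH].
    generalize (pos_INR n); lra.
Qed.

Lemma gamma_integrand_le x y t : 0 < t -> 1 <= x <= y ->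
  gamma_integrand x t <= gamma_integrand 1 t + gamma_integrand y t.
Proof.
  intros Ht [H1 Hxy]. unfold gamma_integrand.
  rewrite <- Rmult_plus_distr_r. apply Rmult_le_compat_r; [left; apply exp_pos|].
  rewrite Rminus_diag, Rpower_O by lra.
  assert (0 < Rpower t (y - 1)) by apply exp_pos.
  destruct (Rle_or_lt t 1) as [Ht1 | Ht1].
  - assert (ln t <= 0) by (rewrite <- ln_1; now apply ln_le).
    enough (Rpower t (x - 1) <= 1) by lra.
    apply Rle_trans with (exp 0); [|rewrite exp_0; lra]. apply exp_le_compat. nra.
  - enough (Rpower t (x - 1) <= Rpower t (y - 1)) by lra.
    apply Rle_Rpower; lra.
Qed.

(** For [x >= 1] the integrand is dominated by the sum of those for [1] and for
    a large integer; smaller [x] are reached by one step of [gamma_bounded_succ]. *)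
Lemma gamma_bounded_pos x : 0 < x -> gamma_bounded x.
Proof.
  assert (G : forall x, 1 <= x -> gamma_bounded x).
  { intros y Hy. destruct (INR_unbounded y) as [n Hn].
    destruct gamma_bounded_1 as [C1 H1]. destruct (gamma_bounded_INR n) as [C2 H2].
    exists (C1 + C2). intros a b Ha Hab.
    apply Rle_trans with
      (RInt (fun t => plus (gamma_integrand 1 t) (gamma_integrand (INR n + 1) t)) a b).
    - apply RInt_le; [easy | now apply ex_RInt_gamma_integrand | |].
      + apply (ex_RInt_plus (gamma_integrand 1));
          now apply ex_RInt_gamma_integrand.
      + intros t Ht. apply gamma_integrand_le; lra.
    - rewrite (RInt_plus (gamma_integrand 1)) by now apply ex_RInt_gamma_integrand.
      apply Rplus_le_compat; auto. }
  intros Hx. apply gamma_bounded_succ, G; lra.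
Qed.

Lemma Gamma_spec x : 0 < x ->
  is_RInt_gen (gamma_integrand x) (at_right 0) (Rbar_locally p_infty) (Gamma x) /\
  (forall a b, 0 < a -> a <= b -> RInt (gamma_integrand x) a b <= Gamma x) /\
  (forall M, (forall a b, 0 < a -> a <= b -> RInt (gamma_integrand x) a b <= M) ->
     Gamma x <= M).
Proof.
  intros Hx. destruct (gamma_bounded_pos x Hx) as [C HC].
  destruct (is_RInt_gen_of_bounded (gamma_integrand x) C) as (l & Hl & H2); auto.
  - intros t Ht. now apply continuous_gamma_integrand.
  - intros t _. left; apply gamma_integrand_pos.
  - assert (E : Gamma x = l)
      by exact (is_RInt_gen_unique (V := R_CompleteNormedModule) _ _ Hl).
    rewrite E. split; assumption.
Qed.

Lemma Gamma_pos x : 0 < x -> 0 < Gamma x.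
Proof.
  intros Hx. destruct (Gamma_spec x Hx) as (_ & H & _).
  apply Rlt_le_trans with (RInt (gamma_integrand x) 1 2); [|apply H; lra].
  apply RInt_gt_0; [lra | intros; apply gamma_integrand_pos |].
  intros; apply continuous_gamma_integrand; lra.
Qed.

Lemma filter_prod_pos (P : R -> Prop) : (forall t, 0 < t -> P t) ->
  filter_prod (at_right 0) (Rbar_locally p_infty)
    (fun ab => forall t, Rmin (fst ab) (snd ab) <= t <= Rmax (fst ab) (snd ab) -> P t).
Proof.
  intros HP. apply Filter_prod with (fun a => 0 < a) (fun b => 0 < b).
  - exists (mkposreal 1 Rlt_0_1). tauto.
  - exists 0. tauto.
  - intros a b Ha Hb t [Ht _]. apply HP. simpl in Ht.
    apply Rlt_le_trans with (2 := Ht). now apply Rmin_glb_lt.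
Qed.

Lemma is_RInt_gen_antiderivative (F f : R -> R) (la lb : R)
  (hd : forall t, 0 < t -> is_derive F t (f t))
  (hc : forall t, 0 < t -> continuous f t)
  (ha : filterlim F (at_right 0) (locally la))
  (hb : filterlim F (Rbar_locally p_infty) (locally lb)) :
  is_RInt_gen f (at_right 0) (Rbar_locally p_infty) (lb - la).
Proof.
  assert (E : forall t, 0 < t -> Derive F t = f t).
  { intros t Ht. now apply is_derive_unique, hd. }
  apply is_RInt_gen_ext with (Derive F).
  { generalize (filter_prod_pos _ E). apply filter_imp. intros ab H t Ht. apply H; lra. }
  apply is_RInt_gen_Derive; auto; apply filter_prod_pos.
  - intros t Ht. exists (f t). now apply hd.
  - intros t Ht. apply continuous_ext_loc with f; [|now apply hc].
    exists (mkposreal t Ht). intros y Hy. symmetry. apply E.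
    apply Rabs_lt_between' in Hy. simpl in Hy. lra.
Qed.

Lemma filterlim_gamma_boundary_0 x : 0 < x ->
  filterlim (gamma_boundary x) (at_right 0) (locally 0).
Proof.
  intros Hx P [eps HP].
  exists (mkposreal (Rpower eps (/ x)) (exp_pos _)). intros t Ht Ht0.
  apply Rabs_lt_between' in Ht. simpl in Ht. apply HP, Rabs_lt_between'.
  generalize (gamma_boundary_pos x t); intros.
  enough (gamma_boundary x t < eps) by lra.
  apply Rle_lt_trans with (Rpower t x).
  - unfold gamma_boundary. rewrite <- (Rmult_1_r (Rpower t x)) at 2.
    apply Rmult_le_compat_l; [left; apply exp_pos|].
    rewrite <- exp_0. apply exp_le_compat; lra.
  - replace (pos eps) with (Rpower (Rpower eps (/ x)) x).
    + apply Rlt_Rpower_l; lra.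
    + rewrite Rpower_mult, Rinv_l, Rpower_1; [easy | apply cond_pos | lra].
Qed.

Lemma filterlim_gamma_boundary_infty x : 0 <= x ->
  filterlim (gamma_boundary x) (Rbar_locally p_infty) (locally 0).
Proof.
  intros Hx P [eps HP]. set (K := exp ((x + 1) * ln (x + 1))).
  assert (HK : 0 < K) by apply exp_pos.
  exists (K / eps). intros t Ht.
  assert (Ht0 : 0 < t).
  { apply Rlt_trans with (2 := Ht). apply Rdiv_lt_0_compat; [easy | apply cond_pos]. }
  apply HP, Rabs_lt_between'.
  generalize (gamma_boundary_pos x t); intros.
  enough (gamma_boundary x t < eps) by lra.
  apply Rmult_lt_reg_l with t; [easy|].
  apply Rle_lt_trans with K.
  - replace (t * gamma_boundary x t) with (gamma_boundary (x + 1) t).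
    + apply gamma_boundary_le; lra.
    + unfold gamma_boundary. rewrite Rpower_plus, Rpower_1 by easy. ring.
  - destruct eps as [e He]; simpl in *.
    apply Rmult_lt_compat_r with (r := e) in Ht; [|easy].
    replace (K / e * e) with K in Ht by (field; lra). exact Ht.
Qed.

(** The antiderivative of [exp (- t)] is written as [- gamma_boundary 0], so that
    its limit at infinity is the one already computed. *)
Lemma Gamma_1 : Gamma 1 = 1.
Proof.
  destruct (Gamma_spec 1 Rlt_0_1) as [H _].
  apply (is_RInt_gen_unique (V := R_CompleteNormedModule)) in H. rewrite <- H.
  apply is_RInt_gen_unique. replace 1 with (0 - - 1) at 2 by ring.
  apply (is_RInt_gen_antiderivative (fun t => - gamma_boundary 0 t)).
  - intros t Ht.
    replace (gamma_integrand 1 t)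
      with (opp (0 * gamma_integrand 0 t - gamma_integrand (0 + 1) t)).
    + apply (is_derive_opp (gamma_boundary 0)). now apply is_derive_gamma_boundary.
    + rewrite Rplus_0_l. unfold opp; simpl. ring.
  - intros t Ht. now apply continuous_gamma_integrand.
  - assert (L : filterlim (fun t => - exp (- t)) (at_right 0) (locally (- exp (- 0)))).
    { eapply filterlim_filter_le_1; [apply filter_le_within; typeclasses eauto |].
      apply (ex_derive_continuous (fun t => - exp (- t))). auto_derive. easy. }
    rewrite Ropp_0, exp_0 in L.
    apply (filterlim_ext_loc (fun t => - exp (- t))); [|exact L].
    exists (mkposreal 1 Rlt_0_1). intros t _ Ht. unfold gamma_boundary.
    rewrite Rpower_O by easy. ring.
  - rewrite <- Ropp_0. apply filterlim_comp with (2 := filterlim_opp (V := R_NormedModule) 0).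
    apply filterlim_gamma_boundary_infty. lra.
Qed.

(** Integration by parts over the whole half-line: the boundary term vanishes at
    both ends. *)
Lemma Gamma_succ x : 0 < x -> Gamma (x + 1) = x * Gamma x.
Proof.
  intros Hx. destruct (Gamma_spec x Hx) as [H _].
  assert (Hx1 : 0 < x + 1) by lra. destruct (Gamma_spec _ Hx1) as [H1 _].
  assert (A : is_RInt_gen
    (fun t => minus (scal x (gamma_integrand x t)) (gamma_integrand (x + 1) t))
    (at_right 0) (Rbar_locally p_infty) (0 - 0)).
  { apply (is_RInt_gen_antiderivative (gamma_boundary x)).
    - intros t Ht. now apply is_derive_gamma_boundary.
    - intros t Ht. apply (continuous_minus (fun t => x * gamma_integrand x t)).
      + apply (continuous_scal_r x (gamma_integrand x)); now apply continuous_gamma_integrand.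
      + now apply continuous_gamma_integrand.
    - now apply filterlim_gamma_boundary_0.
    - apply filterlim_gamma_boundary_infty; lra. }
  assert (B := is_RInt_gen_minus _ _ _ _ (is_RInt_gen_scal _ x _ H) H1).
  apply (is_RInt_gen_unique (V := R_CompleteNormedModule)) in A.
  apply (is_RInt_gen_unique (V := R_CompleteNormedModule)) in B.
  assert (E : 0 - 0 = x * Gamma x - Gamma (x + 1)) by (rewrite <- A; exact B).
  lra.
Qed.

Definition convex_pos (f : R -> R) : Prop :=
  forall x y p, 0 < x -> 0 < y -> 0 <= p <= 1 ->
    f (p * x + (1 - p) * y) <= p * f x + (1 - p) * f y.

(** Both exponentials on the right lie above the tangent line of [exp] at the
    averaged point. *)
Lemma exp_convex p u v : 0 <= p <= 1 ->
  exp (p * u + (1 - p) * v) <= p * exp u + (1 - p) * exp v.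
Proof.
  intros Hp. set (w := p * u + (1 - p) * v).
  assert (T : forall z, exp w * (1 + (z - w)) <= exp z).
  { intros z. replace (exp z) with (exp w * exp (z - w)).
    - apply Rmult_le_compat_l; [left; apply exp_pos | apply exp_ineq1_le].
    - rewrite <- exp_plus. f_equal. ring. }
  assert (p * (exp w * (1 + (u - w))) <= p * exp u)
    by (apply Rmult_le_compat_l; [lra | apply T]).
  assert ((1 - p) * (exp w * (1 + (v - w))) <= (1 - p) * exp v)
    by (apply Rmult_le_compat_l; [lra | apply T]).
  replace (exp w) with
    (p * (exp w * (1 + (u - w))) + (1 - p) * (exp w * (1 + (v - w))))
    by (unfold w at 2 4; ring).
  lra.
Qed.

Definition ln_Gamma (x : R) : R := ln (Gamma x).

(** Hoelder's inequality, by way of Young's: at every [t], convexity of [exp]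
    bounds the integrand at [z = p x + (1 - p) y], divided by
    [Gamma x ^ p * Gamma y ^ (1 - p)], by the average with weights [p] and [1 - p]
    of the two integrands normalized to have integral [1]. *)
Lemma ln_Gamma_convex : convex_pos ln_Gamma.
Proof.
  intros x y p Hx Hy Hp. unfold ln_Gamma. set (z := p * x + (1 - p) * y).
  assert (Hz : 0 < z) by (unfold z; nra).
  set (m := p * ln (Gamma x) + (1 - p) * ln (Gamma y)).
  assert (PX := Gamma_pos x Hx). assert (PY := Gamma_pos y Hy).
  rewrite <- (ln_exp m). apply ln_le; [now apply Gamma_pos|].
  apply (Gamma_spec z Hz). intros a b Ha Hab.
  (* [exp m] is [Gamma x ^ p * Gamma y ^ (1 - p)], and [k q w] is the part of the
     Young majorant that comes from the weight [q] at the point [w]. *)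
  set (k := fun (q w t : R) => scal (exp m * (q / Gamma w)) (gamma_integrand w t)).
  assert (ek : forall q w, ex_RInt (k q w) a b).
  { intros q w. apply (ex_RInt_scal (gamma_integrand w)). now apply ex_RInt_gamma_integrand. }
  apply Rle_trans with (RInt (fun t => plus (k p x t) (k (1 - p) y t)) a b).
  - apply RInt_le; [easy | now apply ex_RInt_gamma_integrand | |].
    + now apply (ex_RInt_plus (k p x)).
    + intros t Ht.
      assert (Q : forall w, 0 < w ->
        gamma_integrand w t / Gamma w = exp ((w - 1) * ln t - t - ln (Gamma w))).
      { intros w Hw. unfold gamma_integrand, Rpower.
        replace ((w - 1) * ln t - t - ln (Gamma w))
          with ((w - 1) * ln t + - t + - ln (Gamma w)) by ring.
        rewrite 2!exp_plus, (exp_Ropp (ln _)), exp_ln by now apply Gamma_pos.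
        reflexivity. }
      change (gamma_integrand z t
        <= exp m * (p / Gamma x) * gamma_integrand x t
           + exp m * ((1 - p) / Gamma y) * gamma_integrand y t).
      replace (exp m * (p / Gamma x) * gamma_integrand x t
           + exp m * ((1 - p) / Gamma y) * gamma_integrand y t)
        with (exp m * (p * (gamma_integrand x t / Gamma x)
                        + (1 - p) * (gamma_integrand y t / Gamma y)))
        by (field; lra).
      rewrite 2!Q by assumption.
      apply Rle_trans with (exp m * exp (p * ((x - 1) * ln t - t - ln (Gamma x))
        + (1 - p) * ((y - 1) * ln t - t - ln (Gamma y)))).
      * rewrite <- exp_plus. unfold gamma_integrand, Rpower. rewrite <- exp_plus.
        right. f_equal. unfold m, z. ring.
      * apply Rmult_le_compat_l; [left; apply exp_pos | now apply exp_convex].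
  - rewrite (RInt_plus (k p x)) by apply ek. unfold k.
    rewrite (RInt_scal (gamma_integrand x)), (RInt_scal (gamma_integrand y))
      by now apply ex_RInt_gamma_integrand.
    change (exp m * (p / Gamma x) * RInt (gamma_integrand x) a b
      + exp m * ((1 - p) / Gamma y) * RInt (gamma_integrand y) a b <= exp m).
    assert (W : forall q w, 0 <= q -> 0 < w ->
      exp m * (q / Gamma w) * RInt (gamma_integrand w) a b <= exp m * q).
    { intros q w Hq Hw. assert (PW := Gamma_pos w Hw).
      apply Rle_trans with (exp m * (q / Gamma w) * Gamma w).
      - apply Rmult_le_compat_l; [|now apply (Gamma_spec w Hw)].
        apply Rmult_le_pos; [left; apply exp_pos|].
        apply Rmult_le_pos; [easy | left; now apply Rinv_0_lt_compat].
      - right. field. lra. }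
    generalize (W p x) (W (1 - p) y); intros. lra.
Qed.

(** * Gauss's product for the gamma function *)

Lemma ln_sub_le u v : 0 < u -> 0 < v -> ln u - ln v <= (u - v) / v.
Proof.
  intros Hu Hv. rewrite <- ln_div by assumption.
  replace ((u - v) / v) with (u / v - 1) by (field; lra).
  apply ln_le_sub_1. now apply Rdiv_lt_0_compat.
Qed.

Lemma is_lim_seq_div_INR K c : is_lim_seq (fun n => K / (INR n + c)) 0.
Proof.
  replace (Finite 0) with (Rbar_mult K (Rbar_inv p_infty))
    by (simpl; f_equal; ring).
  apply (is_lim_seq_scal_l (fun n => / (INR n + c))).
  apply is_lim_seq_inv; [|easy].
  apply is_lim_seq_plus with p_infty c;
    [apply is_lim_seq_INR | apply is_lim_seq_const | easy].
Qed.

(** The general term of Gauss's product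
    [Gamma s = lim N! * N ^ (s - 1) / (s * (s + 1) * ... * (s + N - 1))], in
    logarithmic form and with [N ^ (s - 1)] telescoped. *)
Definition ln_Gamma_term (s : R) (n : nat) : R :=
  (s - 1) * (ln (INR n + 2) - ln (INR n + 1)) - ln (s + INR n) + ln (INR n + 1).

(** The slope of a convex function over [[M, M + s]] is at least the slope over
    [[M - 1, M]] and at most the slope over [[M + s, M + s + 1]].  For functions
    with [f (x + 1) = f x + ln x] the unit slopes are logarithms. *)
Lemma convex_pos_slope_ge f s M : convex_pos f -> 0 < s -> 1 < M ->
  s * (f M - f (M - 1)) <= f (M + s) - f M.
Proof.
  intros Hf Hs HM.
  assert (Hi : 0 < / (1 + s) < 1).
  { split; [apply Rinv_0_lt_compat; lra|].
    rewrite <- Rinv_1. apply Rinv_lt_contravar; lra. }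
  generalize (Hf (M + s) (M - 1) (/ (1 + s)) ltac:(lra) ltac:(lra) ltac:(lra)).
  replace (/ (1 + s) * (M + s) + (1 - / (1 + s)) * (M - 1)) with M by (field; lra).
  intros H. apply Rmult_le_compat_l with (r := 1 + s) in H; [|lra].
  replace ((1 + s) * (/ (1 + s) * f (M + s) + (1 - / (1 + s)) * f (M - 1)))
    with (f (M + s) + s * f (M - 1)) in H by (field; lra).
  lra.
Qed.

Lemma convex_pos_slope_le f s M : convex_pos f -> 0 < s -> 0 < M ->
  f (M + s) - f M <= s * (f (M + s + 1) - f (M + s)).
Proof.
  intros Hf Hs HM.
  assert (Hi : 0 < / (1 + s) < 1).
  { split; [apply Rinv_0_lt_compat; lra|].
    rewrite <- Rinv_1. apply Rinv_lt_contravar; lra. }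
  generalize (Hf M (M + s + 1) (/ (1 + s)) ltac:(lra) ltac:(lra) ltac:(lra)).
  replace (/ (1 + s) * M + (1 - / (1 + s)) * (M + s + 1)) with (M + s) by (field; lra).
  intros H. apply Rmult_le_compat_l with (r := 1 + s) in H; [|lra].
  replace ((1 + s) * (/ (1 + s) * f M + (1 - / (1 + s)) * f (M + s + 1)))
    with (f M + s * f (M + s + 1)) in H by (field; lra).
  lra.
Qed.

(** The functional equation turns the [N]-th partial sum into [f s] plus an error
    that involves [f] only through the increment [f (M + s) - f M] with [M = N + 1].
    Convexity pins that increment between [s * ln (M - 1)] and [s * ln (M + s)],
    so the error is [O(1 / N)]. *)
Lemma bohr_mollerup (f : R -> R) (s : R)
  (hconv : convex_pos f) (h1 : f 1 = 0)
  (hsucc : forall x, 0 < x -> f (x + 1) = f x + ln x) (hs : 0 < s) :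
  is_series (ln_Gamma_term s) (f s).
Proof.
  assert (E : forall N, sum_n (ln_Gamma_term s) N
    = f s - (f (INR N + 1 + s) - f (INR N + 1))
      + (s - 1) * ln (INR N + 2) + ln (INR N + 1) :> R).
  { induction N as [|N IH].
    - rewrite sum_O. unfold ln_Gamma_term. simpl INR. rewrite Rplus_0_l, Rplus_0_l, h1.
      replace (1 + s) with (s + 1) by ring. rewrite hsucc by assumption.
      rewrite Rplus_0_r, ln_1. ring.
    - rewrite sum_Sn, IH. change (@plus R_AbelianMonoid) with Rplus. unfold ln_Gamma_term.
      assert (HN := pos_INR N). rewrite !S_INR.
      replace (INR N + 1 + 1 + s) with (INR N + 1 + s + 1) by ring.
      rewrite (hsucc (INR N + 1 + s)), (hsucc (INR N + 1)) by lra.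
      replace (s + (INR N + 1)) with (INR N + 1 + s) by ring.
      replace (INR N + 1 + 1) with (INR N + 2) by ring. ring. }
  change (is_lim_seq (sum_n (ln_Gamma_term s)) (f s)).
  apply is_lim_seq_le_le_loc with
    (fun N => f s - (s * s + 1) / (INR N + 1)) (fun N => f s + 2 * s / (INR N + 0)).
  - exists 1%nat. intros N HN. rewrite E.
    assert (HN1 : 1 <= INR N) by (apply (le_INR 1); lia).
    set (M := INR N + 1).
    replace (INR N + 2) with (M + 1) by (unfold M; ring).
    replace (INR N + 0) with (M - 1) by (unfold M; ring).
    assert (HM : 2 <= M) by (unfold M; lra). clearbody M.
    generalize (convex_pos_slope_ge f s M hconv hs ltac:(lra))
      (convex_pos_slope_le f s M hconv hs ltac:(lra)).
    rewrite (hsucc (M + s)) by lra.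
    replace (f M) with (f (M - 1) + ln (M - 1)) at 1
      by (rewrite <- hsucc by lra; f_equal; ring).
    intros L U.
    generalize (ln_sub_le (M + s) (M + 1) ltac:(lra) ltac:(lra))
      (ln_sub_le (M + 1) M ltac:(lra) ltac:(lra))
      (ln_sub_le (M + 1) (M - 1) ltac:(lra) ltac:(lra))
      (ln_le M (M + 1) ltac:(lra) ltac:(lra)).
    intros A1 A2 A3 A4. split.
    + assert (s * (ln (M + s) - ln (M + 1)) <= s * ((M + s - (M + 1)) / (M + 1)))
        by (apply Rmult_le_compat_l; lra).
      assert (s * ((M + s - (M + 1)) / (M + 1)) <= s * s / M).
      { apply Rmult_le_reg_l with (M * (M + 1)); [nra|].
        replace (M * (M + 1) * (s * ((M + s - (M + 1)) / (M + 1))))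
          with (M * s * (s - 1)) by (field; lra).
        replace (M * (M + 1) * (s * s / M)) with ((M + 1) * s * s) by (field; lra).
        nra. }
      replace ((M + 1 - M) / M) with (/ M) in A2 by (field; lra).
      replace ((s * s + 1) / M) with (s * s / M + / M) by (field; lra).
      lra.
    + assert (s * (ln (M + 1) - ln (M - 1)) <= s * ((M + 1 - (M - 1)) / (M - 1)))
        by (apply Rmult_le_compat_l; lra).
      replace (s * ((M + 1 - (M - 1)) / (M - 1))) with (2 * s / (M - 1)) in H
        by (field; lra).
      lra.
  - replace (Finite (f s)) with (Rbar_minus (f s) 0) by (simpl; f_equal; ring).
    apply is_lim_seq_minus'; [apply is_lim_seq_const | apply is_lim_seq_div_INR].
  - replace (Finite (f s)) with (Rbar_plus (f s) 0) by (simpl; f_equal; ring).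
    apply is_lim_seq_plus'; [apply is_lim_seq_const | apply is_lim_seq_div_INR].
Qed.

Lemma ln_Gamma_1 : ln_Gamma 1 = 0.
Proof. unfold ln_Gamma. now rewrite Gamma_1, ln_1. Qed.

Lemma ln_Gamma_succ x : 0 < x -> ln_Gamma (x + 1) = ln_Gamma x + ln x.
Proof.
  intros Hx. unfold ln_Gamma. rewrite Gamma_succ, ln_mult; auto using Gamma_pos. ring.
Qed.

Lemma ln_Gamma_2 : ln_Gamma 2 = 0.
Proof.
  replace 2 with (1 + 1) by ring. rewrite ln_Gamma_succ, ln_Gamma_1, ln_1 by lra. ring.
Qed.

Lemma is_series_ln_Gamma s : 0 < s -> is_series (ln_Gamma_term s) (ln_Gamma s).
Proof.
  intros Hs. apply bohr_mollerup; auto using ln_Gamma_1, ln_Gamma_succ, ln_Gamma_convex.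
Qed.

Lemma is_series_telescope (v : nat -> R) (l : R) :
  is_lim_seq v l -> is_series (fun n => v n - v (S n)) (v 0%nat - l).
Proof.
  intros Hv.
  change (is_lim_seq (sum_n (fun n => v n - v (S n))) (v 0%nat - l)).
  apply (is_lim_seq_ext (fun n => v 0%nat - v (S n))).
  - induction n as [|n IH]; [symmetry; apply sum_O|].
    rewrite sum_Sn, <- IH.
    change (v 0%nat - v (S (S n)) = v 0%nat - v (S n) + (v (S n) - v (S (S n)))). ring.
  - apply is_lim_seq_minus'; [apply is_lim_seq_const | exact (proj1 (is_lim_seq_incr_1 v l) Hv)].
Qed.

Lemma ex_series_Rmult_l (k : R) (a : nat -> R) :
  ex_series a -> ex_series (fun n => k * a n).
Proof. exact (ex_series_scal (V := R_NormedModule) k a). Qed.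

(** Comparison with a multiple of [1 / (s + n) - 1 / (s + n + 1)]; the factor
    [(s + 1) / s] bounds [(s + n + 1) / (s + n)]. *)
Lemma ex_series_inv_sq s : 0 < s -> ex_series (fun n => / (s + INR n) ^ 2).
Proof.
  intros Hs. apply (@ex_series_le R_AbsRing R_CompleteNormedModule) with
    (fun n => (s + 1) / s * (1 / (INR n + s) - 1 / (INR (S n) + s))).
  - intros n. assert (Hn := pos_INR n). rewrite S_INR. set (m := INR n) in *.
    assert (H2 : 0 < (s + m) ^ 2) by (apply pow_lt; lra).
    assert (Hi : 0 < / (s + m) ^ 2) by now apply Rinv_0_lt_compat.
    change (norm (/ (s + m) ^ 2)) with (Rabs (/ (s + m) ^ 2)).
    rewrite Rabs_pos_eq by lra.
    apply Rmult_le_reg_l with (s * (s + m) ^ 2 * (m + 1 + s));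
      [repeat apply Rmult_lt_0_compat; lra|].
    replace (s * (s + m) ^ 2 * (m + 1 + s) * / (s + m) ^ 2) with (s * (m + 1 + s))
      by (field; lra).
    replace (s * (s + m) ^ 2 * (m + 1 + s) *
      ((s + 1) / s * (1 / (m + s) - 1 / (m + 1 + s)))) with ((s + 1) * (m + s))
      by (field; lra).
    nra.
  - apply (ex_series_Rmult_l ((s + 1) / s)).
    eexists. apply is_series_telescope, is_lim_seq_div_INR.
Qed.

Lemma ex_series_inv_sq_le (a : nat -> R) (K s : R) : 0 < s ->
  (forall n, Rabs (a n) <= K / (s + INR n) ^ 2) -> ex_series a.
Proof.
  intros Hs H.
  apply (@ex_series_le R_AbsRing R_CompleteNormedModule) with (1 := H).
  apply (ex_series_Rmult_l K). now apply ex_series_inv_sq.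
Qed.

(** * Term-by-term differentiation: the polygamma series *)

(** When the second-order Taylor remainders of the terms at [x] are summable,
    uniformly in a neighbourhood, they add up to a second-order remainder for the
    sum. *)
Lemma is_derive_series (f : nat -> R -> R) (d M : nat -> R) (F : R -> R) (D x r : R)
  (hr : 0 < r) (hM : ex_series M)
  (hF : forall y, Rabs (y - x) < r -> is_series (fun n => f n y) (F y))
  (hD : is_series d D)
  (hrem : forall n y, Rabs (y - x) < r ->
     Rabs (f n y - f n x - (y - x) * d n) <= M n * (y - x) ^ 2) :
  is_derive F x D.
Proof.
  apply is_derive_Reals. intros eps Heps.
  set (K := Series M).
  assert (R0 : forall h, Rabs h < r -> Rabs (F (x + h) - F x - h * D) <= K * h ^ 2).
  { intros h Hh. assert (Hy : x + h - x = h) by ring.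
    assert (A : is_series (fun n => f n (x + h) - f n x - h * d n)
                          (F (x + h) - F x - h * D)).
    { apply (is_series_minus (fun n => f n (x + h) - f n x)).
      - apply (is_series_minus (fun n => f n (x + h))); apply hF.
        + now rewrite Hy.
        + rewrite Rminus_diag, Rabs_R0. exact hr.
      - exact (is_series_scal (V := R_NormedModule) h _ _ hD). }
    assert (B : forall n, Rabs (f n (x + h) - f n x - h * d n) <= M n * h ^ 2).
    { intros n. generalize (hrem n (x + h)). rewrite Hy. auto. }
    assert (C : ex_series (fun n => M n * h ^ 2)) by exact (ex_series_scal_r _ _ hM).
    rewrite <- (is_series_unique _ _ A).
    apply Rle_trans with (Series (fun n => Rabs (f n (x + h) - f n x - h * d n))).
    - apply Series_Rabs.
      apply (@ex_series_le R_AbsRing R_CompleteNormedModule) with (2 := C).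
      intros n. change (Rabs (Rabs (f n (x + h) - f n x - h * d n)) <= M n * h ^ 2).
      now rewrite Rabs_Rabsolu.
    - unfold K. rewrite <- Series_scal_r. apply Series_le; [|exact C].
      intros n. split; [apply Rabs_pos | apply B]. }
  assert (HK : 0 <= K).
  { assert (H : Rabs (r / 2) < r) by (rewrite Rabs_pos_eq; lra).
    apply R0 in H. generalize (Rabs_pos (F (x + r / 2) - F x - r / 2 * D)). intros Hp.
    apply Rmult_le_reg_r with ((r / 2) ^ 2); [apply pow_lt; lra | lra]. }
  assert (Hdel : 0 < Rmin r (eps / (K + 1))).
  { apply Rmin_glb_lt; [exact hr | apply Rdiv_lt_0_compat; lra]. }
  exists (mkposreal _ Hdel). intros h Hh0 Hh. simpl in Hh.
  assert (Hh1 : Rabs h < r) by (apply Rlt_le_trans with (1 := Hh), Rmin_l).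
  assert (Hh2 : Rabs h < eps / (K + 1)) by (apply Rlt_le_trans with (1 := Hh), Rmin_r).
  assert (Ha : 0 < Rabs h) by now apply Rabs_pos_lt.
  replace ((F (x + h) - F x) / h - D) with ((F (x + h) - F x - h * D) / h)
    by (field; exact Hh0).
  rewrite Rabs_div by exact Hh0.
  apply Rmult_lt_reg_r with (Rabs h); [exact Ha|].
  unfold Rdiv. rewrite Rmult_assoc, Rinv_l, Rmult_1_r by lra.
  apply Rle_lt_trans with (1 := R0 h Hh1).
  rewrite <- (pow2_abs h).
  apply Rmult_lt_compat_l with (r := K + 1) in Hh2; [|lra].
  replace ((K + 1) * (eps / (K + 1))) with eps in Hh2 by (field; lra).
  nra.
Qed.

Definition digamma_term (s : R) (n : nat) : R :=
  ln (INR n + 2) - ln (INR n + 1) - / (s + INR n).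

Definition digamma_series (s : R) : R := Series (digamma_term s).

Definition trigamma (s : R) : R := Series (fun n => / (s + INR n) ^ 2).

(** This is [- psi''], which is positive. *)
Definition neg_tetragamma (s : R) : R := Series (fun n => 2 / (s + INR n) ^ 3).

(** The remainder is at most [(y - x) ^ 2 / (x * y)]; [x / 2 <= y] turns [y] into
    [x] in the denominator, here and in the next two lemmas, so that the bounds
    are uniform for [y] near [x]. *)
Lemma ln_taylor x y : 0 < x -> x / 2 <= y ->
  Rabs (ln y - ln x - (y - x) / x) <= 2 / x ^ 2 * (y - x) ^ 2.
Proof.
  intros Hx Hy.
  generalize (ln_sub_le y x ltac:(lra) Hx) (ln_sub_le x y Hx ltac:(lra)); intros U L.
  rewrite Rabs_left1 by lra.
  apply Rle_trans with ((y - x) / x + (x - y) / y); [lra|].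
  apply Rmult_le_reg_l with (x ^ 2 * y); [apply Rmult_lt_0_compat; [apply pow_lt|]; lra|].
  replace (x ^ 2 * y * ((y - x) / x + (x - y) / y)) with (x * (y - x) ^ 2)
    by (field; lra).
  replace (x ^ 2 * y * (2 / x ^ 2 * (y - x) ^ 2)) with (2 * y * (y - x) ^ 2)
    by (field; lra).
  apply Rmult_le_compat_r; [apply pow2_ge_0 | lra].
Qed.

Lemma inv_taylor x y : 0 < x -> x / 2 <= y ->
  Rabs (/ y - / x + (y - x) / x ^ 2) <= 2 / x ^ 3 * (y - x) ^ 2.
Proof.
  intros Hx Hy.
  replace (/ y - / x + (y - x) / x ^ 2) with ((y - x) ^ 2 / (x ^ 2 * y)) by (field; lra).
  assert (Hp : 0 < x ^ 3 * y) by (apply Rmult_lt_0_compat; [apply pow_lt; lra | lra]).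
  rewrite Rabs_pos_eq.
  - apply Rmult_le_reg_l with (x ^ 3 * y); [exact Hp|].
    replace (x ^ 3 * y * ((y - x) ^ 2 / (x ^ 2 * y))) with (x * (y - x) ^ 2)
      by (field; lra).
    replace (x ^ 3 * y * (2 / x ^ 3 * (y - x) ^ 2)) with (2 * y * (y - x) ^ 2)
      by (field; lra).
    apply Rmult_le_compat_r; [apply pow2_ge_0 | lra].
  - apply Rdiv_le_0_compat; [apply pow2_ge_0 |].
    apply Rmult_lt_0_compat; [apply pow_lt|]; lra.
Qed.

Lemma inv_sq_taylor x y : 0 < x -> x / 2 <= y ->
  Rabs (/ y ^ 2 - / x ^ 2 + (y - x) * (2 / x ^ 3)) <= 8 / x ^ 4 * (y - x) ^ 2.
Proof.
  intros Hx Hy.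
  replace (/ y ^ 2 - / x ^ 2 + (y - x) * (2 / x ^ 3))
    with ((y - x) ^ 2 * (x + 2 * y) / (x ^ 3 * y ^ 2)) by (field; lra).
  assert (Hp : 0 < x ^ 4 * y ^ 2) by (apply Rmult_lt_0_compat; apply pow_lt; lra).
  assert (H2 := pow2_ge_0 (y - x)).
  rewrite Rabs_pos_eq.
  - apply Rmult_le_reg_l with (x ^ 4 * y ^ 2); [exact Hp|].
    replace (x ^ 4 * y ^ 2 * ((y - x) ^ 2 * (x + 2 * y) / (x ^ 3 * y ^ 2)))
      with (x * (x + 2 * y) * (y - x) ^ 2) by (field; lra).
    replace (x ^ 4 * y ^ 2 * (8 / x ^ 4 * (y - x) ^ 2)) with (8 * y ^ 2 * (y - x) ^ 2)
      by (field; lra).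
    apply Rmult_le_compat_r; [exact H2 | nra].
  - apply Rdiv_le_0_compat; [apply Rmult_le_pos; lra |].
    apply Rmult_lt_0_compat; apply pow_lt; lra.
Qed.

Lemma ln_INR_sub_lim s : 0 < s ->
  is_lim_seq (fun n => ln (s + INR n) - ln (INR n + 1)) 0.
Proof.
  intros Hs.
  apply is_lim_seq_le_le with
    (fun n => (s - 1) / (INR n + s)) (fun n => (s - 1) / (INR n + 1));
    try apply is_lim_seq_div_INR.
  intros n. assert (Hn := pos_INR n).
  generalize (ln_sub_le (s + INR n) (INR n + 1) ltac:(lra) ltac:(lra))
    (ln_sub_le (INR n + 1) (s + INR n) ltac:(lra) ltac:(lra)).
  replace ((s + INR n - (INR n + 1)) / (INR n + 1)) with ((s - 1) / (INR n + 1))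
    by (field; lra).
  replace ((INR n + 1 - (s + INR n)) / (s + INR n)) with (- ((s - 1) / (INR n + s)))
    by (field; lra).
  lra.
Qed.

(** Each term is a telescoping difference of [ln ((s + n) / (n + 1))], which tends
    to [0], plus the Taylor remainder of [ln] over [[s + n, s + n + 1]], which is
    of order [1 / (s + n) ^ 2]. *)
Lemma is_series_digamma s : 0 < s -> is_series (digamma_term s) (digamma_series s).
Proof.
  intros Hs. apply Series_correct.
  set (v := fun n => ln (s + INR n) - ln (INR n + 1)).
  apply (ex_series_ext
    (fun n => plus (v n - v (S n))
       (ln (s + INR (S n)) - ln (s + INR n) - / (s + INR n)))).
  { intros n. unfold v, digamma_term, plus. cbn -[INR]. rewrite S_INR.
    replace (INR n + 1 + 1) with (INR n + 2) by ring. ring. }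
  apply (ex_series_plus (fun n => v n - v (S n))).
  - eexists. now apply is_series_telescope, ln_INR_sub_lim.
  - apply ex_series_inv_sq_le with 2 s; [exact Hs|]. intros n.
    assert (Hn := pos_INR n). rewrite S_INR.
    generalize (ln_taylor (s + INR n) (s + (INR n + 1)) ltac:(lra) ltac:(lra)).
    replace (s + (INR n + 1) - (s + INR n)) with 1 by ring.
    unfold Rdiv at 1. rewrite Rmult_1_l, pow1, Rmult_1_r. easy.
Qed.

Lemma is_series_trigamma s : 0 < s ->
  is_series (fun n => / (s + INR n) ^ 2) (trigamma s).
Proof. intros Hs. now apply Series_correct, ex_series_inv_sq. Qed.

Lemma is_series_neg_tetragamma s : 0 < s ->
  is_series (fun n => 2 / (s + INR n) ^ 3) (neg_tetragamma s).
Proof.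
  intros Hs. apply Series_correct, ex_series_inv_sq_le with (2 / s) s; [exact Hs|].
  intros n. assert (Hn := pos_INR n).
  assert (H3 : 0 < (s + INR n) ^ 3) by (apply pow_lt; lra).
  rewrite Rabs_pos_eq by (apply Rdiv_le_0_compat; lra).
  apply Rmult_le_reg_l with (s * (s + INR n) ^ 3); [apply Rmult_lt_0_compat; lra|].
  replace (s * (s + INR n) ^ 3 * (2 / (s + INR n) ^ 3)) with (2 * s) by (field; lra).
  replace (s * (s + INR n) ^ 3 * (2 / s / (s + INR n) ^ 2)) with (2 * (s + INR n))
    by (field; lra).
  lra.
Qed.

Lemma shift_near s y n : 0 < s -> Rabs (y - s) < s / 2 ->
  0 < y /\ 0 < s + INR n /\ (s + INR n) / 2 <= y + INR n /\
  y + INR n - (s + INR n) = y - s.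
Proof.
  intros Hs Hy. apply Rabs_lt_between' in Hy. assert (Hn := pos_INR n).
  repeat split; lra.
Qed.

Lemma is_derive_ln_Gamma s : 0 < s -> is_derive ln_Gamma s (digamma_series s).
Proof.
  intros Hs. apply is_derive_series with
    (f := fun n y => ln_Gamma_term y n) (d := digamma_term s)
    (M := fun n => 2 / (s + INR n) ^ 2) (r := s / 2); [lra | | | |].
  - apply (ex_series_Rmult_l 2). now apply ex_series_inv_sq.
  - intros y Hy. destruct (shift_near s y 0 Hs Hy) as [Hy0 _].
    now apply is_series_ln_Gamma.
  - now apply is_series_digamma.
  - intros n y Hy. destruct (shift_near s y n Hs Hy) as (_ & H1 & H2 & E).
    generalize (ln_taylor _ _ H1 H2). rewrite E, <- Rabs_Ropp.
    intros H. apply Rle_trans with (2 := H). right. f_equal.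
    unfold ln_Gamma_term, digamma_term. field. lra.
Qed.

Lemma is_derive_digamma_series s : 0 < s -> is_derive digamma_series s (trigamma s).
Proof.
  intros Hs. apply is_derive_series with
    (f := fun n y => digamma_term y n) (d := fun n => / (s + INR n) ^ 2)
    (M := fun n => 2 / s * / (s + INR n) ^ 2) (r := s / 2); [lra | | | |].
  - apply (ex_series_Rmult_l (2 / s)). now apply ex_series_inv_sq.
  - intros y Hy. destruct (shift_near s y 0 Hs Hy) as [Hy0 _].
    now apply is_series_digamma.
  - now apply is_series_trigamma.
  - intros n y Hy. destruct (shift_near s y n Hs Hy) as (_ & H1 & H2 & E).
    generalize (inv_taylor _ _ H1 H2). rewrite E, <- Rabs_Ropp.
    intros H. apply Rle_trans with (2 / (s + INR n) ^ 3 * (y - s) ^ 2).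
    + apply Rle_trans with (2 := H). right. f_equal.
      unfold digamma_term. field. lra.
    + apply Rmult_le_compat_r; [apply pow2_ge_0|].
      assert (Hn := pos_INR n).
      assert (H3 : 0 < (s + INR n) ^ 3) by (apply pow_lt; lra).
      apply Rmult_le_reg_l with (s * (s + INR n) ^ 3); [apply Rmult_lt_0_compat; lra|].
      replace (s * (s + INR n) ^ 3 * (2 / (s + INR n) ^ 3)) with (2 * s)
        by (field; lra).
      replace (s * (s + INR n) ^ 3 * (2 / s * / (s + INR n) ^ 2))
        with (2 * (s + INR n)) by (field; lra).
      lra.
Qed.

Lemma is_derive_trigamma s : 0 < s -> is_derive trigamma s (- neg_tetragamma s).
Proof.
  intros Hs. apply is_derive_series with
    (f := fun n y => / (y + INR n) ^ 2) (d := fun n => - (2 / (s + INR n) ^ 3))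
    (M := fun n => 8 / s ^ 2 * / (s + INR n) ^ 2) (r := s / 2); [lra | | | |].
  - apply (ex_series_Rmult_l (8 / s ^ 2)). now apply ex_series_inv_sq.
  - intros y Hy. destruct (shift_near s y 0 Hs Hy) as [Hy0 _].
    now apply is_series_trigamma.
  - apply (is_series_opp (fun n => 2 / (s + INR n) ^ 3)).
    now apply is_series_neg_tetragamma.
  - intros n y Hy. destruct (shift_near s y n Hs Hy) as (_ & H1 & H2 & E).
    generalize (inv_sq_taylor _ _ H1 H2). rewrite E.
    intros H. apply Rle_trans with (8 / (s + INR n) ^ 4 * (y - s) ^ 2).
    + apply Rle_trans with (2 := H). right. f_equal. ring.
    + apply Rmult_le_compat_r; [apply pow2_ge_0|].
      assert (Hn := pos_INR n).
      assert (H3 : 0 < s ^ 2 * (s + INR n) ^ 4)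
        by (apply Rmult_lt_0_compat; apply pow_lt; lra).
      apply Rmult_le_reg_l with (s ^ 2 * (s + INR n) ^ 4); [exact H3|].
      replace (s ^ 2 * (s + INR n) ^ 4 * (8 / (s + INR n) ^ 4)) with (8 * s ^ 2)
        by (field; lra).
      replace (s ^ 2 * (s + INR n) ^ 4 * (8 / s ^ 2 * / (s + INR n) ^ 2))
        with (8 * (s + INR n) ^ 2) by (field; lra).
      nra.
Qed.

Lemma digamma_eq_series s : 0 < s -> digamma s = digamma_series s.
Proof.
  intros Hs. unfold digamma.
  assert (PG := Gamma_pos s Hs).
  rewrite (is_derive_unique Gamma s (Gamma s * digamma_series s)).
  - field. lra.
  - apply (is_derive_ext_loc (fun y => exp (ln_Gamma y))).
    + exists (mkposreal s Hs). intros y Hy. apply Rabs_lt_between' in Hy. simpl in Hy.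
      apply exp_ln, Gamma_pos. lra.
    + rewrite <- (exp_ln (Gamma s)), Rmult_comm by exact PG.
      apply (is_derive_comp exp ln_Gamma).
      * apply is_derive_exp.
      * now apply is_derive_ln_Gamma.
Qed.

(** * Rational bounds for the polygamma functions *)

Lemma Series_pos (a : nat -> R) :
  (forall n, 0 < a n) -> ex_series a -> 0 < Series a.
Proof.
  intros Ha Hex. rewrite Series_incr_1 by exact Hex.
  assert (H : Series (fun n => 0 * a (S n)) <= Series (fun n => a (S n))).
  { apply Series_le; [|now apply (ex_series_incr_1 a)].
    intros n. specialize (Ha (S n)). lra. }
  rewrite Series_scal_l in H. specialize (Ha 0%nat). lra.
Qed.

Lemma is_series_telescope_inv (q : R -> R) (t : R) :
  continuity_pt q 0 -> q 0 = 0 ->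
  is_series (fun n => q (/ (t + INR n)) - q (/ (t + INR n + 1))) (q (/ t)).
Proof.
  intros Hc H0.
  replace (q (/ t)) with (q (/ (t + INR 0)) - 0) by (simpl; rewrite Rplus_0_r; ring).
  apply (is_series_ext
    (fun n => q (/ (t + INR n)) - q (/ (t + INR (S n))))).
  - intros n. rewrite S_INR, Rplus_assoc. reflexivity.
  - apply (is_series_telescope (fun n => q (/ (t + INR n)))).
    rewrite <- H0. apply is_lim_seq_continuous; [exact Hc|].
    apply (is_lim_seq_ext (fun n => 1 / (INR n + t))); [|apply is_lim_seq_div_INR].
    intros n. rewrite Rplus_comm. unfold Rdiv. apply Rmult_1_l.
Qed.

(** A candidate bound [q (1 / t)] is compared with the series through its
    differences [q (1 / s) - q (1 / (s + 1))], so that only one elementary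
    inequality between rational functions remains.  Taking [q] as a function
    of [1 / s] makes the limit at infinity a matter of continuity at [0]. *)
Lemma telescope_lt_series (q a : R -> R) (t A : R) : 0 < t ->
  continuity_pt q 0 -> q 0 = 0 ->
  (forall s, 0 < s -> q (/ s) - q (/ (s + 1)) < a s) ->
  is_series (fun n => a (t + INR n)) A -> q (/ t) < A.
Proof.
  intros Ht Hc H0 Hlt HA.
  set (b := fun n => a (t + INR n) - (q (/ (t + INR n)) - q (/ (t + INR n + 1)))).
  assert (HD : is_series b (A - q (/ t)))
    by exact (is_series_minus _ _ _ _ HA (is_series_telescope_inv q t Hc H0)).
  enough (0 < A - q (/ t)) by lra.
  rewrite <- (is_series_unique _ _ HD).
  apply Series_pos; [|eexists; exact HD].
  intros n. assert (Hn := pos_INR n). unfold b.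
  generalize (Hlt (t + INR n) ltac:(lra)). lra.
Qed.

Lemma series_lt_telescope (q a : R -> R) (t A : R) : 0 < t ->
  continuity_pt q 0 -> q 0 = 0 ->
  (forall s, 0 < s -> a s < q (/ s) - q (/ (s + 1))) ->
  is_series (fun n => a (t + INR n)) A -> A < q (/ t).
Proof.
  intros Ht Hc H0 Hlt HA. apply Ropp_lt_cancel.
  apply (telescope_lt_series (fun i => - q i) (fun s => - a s) t); [easy | | | |].
  - now apply (continuity_pt_opp q).
  - rewrite H0. ring.
  - intros s Hs. specialize (Hlt s Hs). lra.
  - now apply (is_series_opp (fun n => a (t + INR n))).
Qed.

Lemma trigamma_gt t : 0 < t -> 1 / t + 1 / (2 * t ^ 2) < trigamma t.
Proof.
  intros Ht.
  replace (1 / t + 1 / (2 * t ^ 2)) with (/ t + (/ t) ^ 2 / 2) by (field; lra).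
  apply (telescope_lt_series (fun i => i + i ^ 2 / 2) (fun s => / s ^ 2));
    [easy | reg | field | | now apply is_series_trigamma].
  intros s Hs. apply Rminus_lt_0.
  (* The gap is [(1 / s - 1 / (s + 1)) ^ 2 / 2]. *)
  replace (_ - _) with (/ (2 * s ^ 2 * (s + 1) ^ 2)) by (field; lra).
  apply Rinv_0_lt_compat.
  repeat apply Rmult_lt_0_compat; try apply pow_lt; lra.
Qed.

Lemma trigamma_lt t : 0 < t -> trigamma t < 1 / t + 1 / t ^ 2.
Proof.
  intros Ht.
  replace (1 / t + 1 / t ^ 2) with (/ t + (/ t) ^ 2) by (field; lra).
  apply (series_lt_telescope (fun i => i + i ^ 2) (fun s => / s ^ 2));
    [easy | reg | ring | | now apply is_series_trigamma].
  intros s Hs. apply Rminus_lt_0.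
  replace (_ - _) with (/ (s * (s + 1) ^ 2)) by (field; lra).
  apply Rinv_0_lt_compat, Rmult_lt_0_compat; [|apply pow_lt]; lra.
Qed.

Lemma neg_tetragamma_lt t : 0 < t ->
  neg_tetragamma t < 1 / t ^ 2 + 1 / t ^ 3 + 1 / (2 * t ^ 4).
Proof.
  intros Ht.
  replace (1 / t ^ 2 + 1 / t ^ 3 + 1 / (2 * t ^ 4))
    with ((/ t) ^ 2 + (/ t) ^ 3 + (/ t) ^ 4 / 2) by (field; lra).
  apply (series_lt_telescope (fun i => i ^ 2 + i ^ 3 + i ^ 4 / 2) (fun s => 2 / s ^ 3));
    [easy | reg | field | | now apply is_series_neg_tetragamma].
  intros s Hs. apply Rminus_lt_0.
  replace (_ - _) with ((2 * s + 1) / (2 * s ^ 4 * (s + 1) ^ 4)) by (field; lra).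
  apply Rdiv_lt_0_compat; [lra|].
  repeat apply Rmult_lt_0_compat; try apply pow_lt; lra.
Qed.

Lemma trigamma_pos t : 0 < t -> 0 < trigamma t.
Proof.
  intros Ht. apply Rlt_trans with (2 := trigamma_gt t Ht).
  apply Rplus_lt_0_compat; apply Rdiv_lt_0_compat; try lra.
  apply Rmult_lt_0_compat; [lra | now apply pow_lt].
Qed.

Lemma trigamma_succ t : 0 < t -> trigamma t = / t ^ 2 + trigamma (t + 1).
Proof.
  intros Ht. unfold trigamma at 1.
  rewrite Series_incr_1 by now apply ex_series_inv_sq.
  change (INR 0) with 0. rewrite Rplus_0_r. f_equal. apply Series_ext.
  intros n. rewrite S_INR. do 2 f_equal. ring.
Qed.

(** * The value of the trigamma function at 2 *)

(** The even and the odd terms of the series at [2 t] are a quarter of the terms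
    of the series at [t] and at [t + 1/2]. *)
Lemma trigamma_duplication t : 0 < t ->
  trigamma t + trigamma (t + / 2) = 4 * trigamma (2 * t).
Proof.
  intros Ht.
  set (u := fun s n => / (s + INR n) ^ 2).
  assert (E : forall N,
    4 * sum_n (u (2 * t)) (2 * N + 1) = sum_n (u t) N + sum_n (u (t + / 2)) N).
  { assert (P : forall m, 0 <= m ->
      4 * / (2 * t + 2 * m) ^ 2 = / (t + m) ^ 2 /\
      4 * / (2 * t + (2 * m + 1)) ^ 2 = / (t + / 2 + m) ^ 2)
      by (intros m Hm; split; field; lra).
    induction N as [|N IH].
    - change (2 * 0 + 1)%nat with 1%nat. rewrite sum_Sn, !sum_O.
      change (4 * (u (2 * t) 0%nat + u (2 * t) 1%nat) = u t 0%nat + u (t + / 2) 0%nat).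
      unfold u. simpl INR. destruct (P 0 (Rle_refl 0)) as [P1 P2].
      rewrite <- P1, <- P2. field. lra.
    - replace (2 * S N + 1)%nat with (S (S (2 * N + 1))) by lia.
      rewrite !sum_Sn.
      change (4 * (sum_n (u (2 * t)) (2 * N + 1) + u (2 * t) (S (2 * N + 1))
                 + u (2 * t) (S (S (2 * N + 1))))
        = sum_n (u t) N + u t (S N) + (sum_n (u (t + / 2)) N + u (t + / 2) (S N))).
      rewrite !Rmult_plus_distr_l, IH. unfold u.
      destruct (P (INR (S N)) (pos_INR _)) as [P1 P2]. rewrite <- P1, <- P2.
      rewrite (S_INR (S (2 * N + 1))).
      replace (INR (S (2 * N + 1))) with (2 * INR (S N))
        by (rewrite <- (mult_INR 2); f_equal; lia).
      ring. }
  assert (L1 : is_lim_seq (fun N => 4 * sum_n (u (2 * t)) (2 * N + 1))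
                 (4 * trigamma (2 * t))).
  { apply (is_lim_seq_scal_l _ 4 (trigamma (2 * t))).
    apply (is_lim_seq_subseq (sum_n (u (2 * t))) _ (fun N => (2 * N + 1)%nat)).
    - apply eventually_subseq. intros n. lia.
    - apply is_series_trigamma. lra. }
  assert (L2 : is_lim_seq (fun N => sum_n (u t) N + sum_n (u (t + / 2)) N)
                 (trigamma t + trigamma (t + / 2))).
  { apply is_lim_seq_plus'; apply is_series_trigamma; lra. }
  apply (is_lim_seq_ext _ _ _ E), is_lim_seq_unique in L1.
  apply is_lim_seq_unique in L2. rewrite L1 in L2. now injection L2.
Qed.

Lemma increasing_of_derive_pos (f df : R -> R) (x y : R) : x < y ->
  (forall z, x <= z <= y -> is_derive f z (df z)) ->
  (forall z, x < z < y -> 0 < df z) -> f x < f y.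
Proof.
  intros Hxy Hd Hp.
  destruct (MVT_cor2 f df x y Hxy) as (z & E & Hz).
  - intros z Hz. now apply is_derive_Reals, Hd.
  - specialize (Hp z Hz). assert (0 < df z * (y - x)) by (apply Rmult_lt_0_compat; lra).
    lra.
Qed.

(** Squaring [y * cos y <= sin y] gives [y ^ 2 * (1 - sin y ^ 2) <= sin y ^ 2]. *)
Lemma inv_sin_sq_le y : 0 < y <= PI / 2 -> / sin y ^ 2 <= / y ^ 2 + 1.
Proof.
  intros Hy. assert (Hpi := PI_RGT_0).
  assert (Hs : 0 < sin y) by (apply sin_gt_0; lra).
  assert (Hc : 0 <= cos y) by (apply cos_ge_0; lra).
  assert (H : sin 0 - 0 * cos 0 < sin y - y * cos y).
  { apply (increasing_of_derive_pos (fun y => sin y - y * cos y) (fun y => y * sin y));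
      [lra | |].
    - intros z _. auto_derive; [easy | ring].
    - intros z Hz. apply Rmult_lt_0_compat; [lra | apply sin_gt_0; lra]. }
  rewrite sin_0, Rmult_0_l, Rminus_0_r in H.
  assert (H2 : (y * cos y) ^ 2 <= sin y ^ 2) by (apply pow_incr; split; nra).
  assert (Hcs : cos y ^ 2 = 1 - sin y ^ 2).
  { generalize (sin2_cos2 y). unfold Rsqr. intros. simpl. lra. }
  rewrite Rpow_mult_distr, Hcs in H2.
  assert (Hy2 : 0 < y ^ 2) by (apply pow_lt; lra).
  assert (Hs2 : 0 < sin y ^ 2) by (apply pow_lt; lra).
  apply Rmult_le_reg_l with (y ^ 2 * sin y ^ 2); [now apply Rmult_lt_0_compat|].
  replace (y ^ 2 * sin y ^ 2 * / sin y ^ 2) with (y ^ 2) by (field; lra).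
  replace (y ^ 2 * sin y ^ 2 * (/ y ^ 2 + 1)) with (sin y ^ 2 + y ^ 2 * sin y ^ 2)
    by (field; lra).
  lra.
Qed.

(** The defect of the reflection formula
    [psi' x + psi' (1 - x) = PI ^ 2 / sin (PI * x) ^ 2]. *)
Definition reflection_defect (x : R) : R :=
  PI ^ 2 / sin (PI * x) ^ 2 - (trigamma x + trigamma (1 - x)).

(** Both halves of the defect satisfy the same duplication formula: for the sine
    it is [1 / sin ^ 2 + 1 / cos ^ 2 = 4 / sin (2 y) ^ 2].  The arguments are
    arranged so that [(0, 1/2]] is mapped into itself. *)
Lemma reflection_defect_duplication x : 0 < x < 1 ->
  reflection_defect x =
  (reflection_defect (x / 2) + reflection_defect ((1 - x) / 2)) / 4.
Proof.
  intros Hx. unfold reflection_defect. assert (Hpi := PI_RGT_0).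
  generalize (trigamma_duplication (x / 2) ltac:(lra))
    (trigamma_duplication ((1 - x) / 2) ltac:(lra)).
  replace (x / 2 + / 2) with (1 - (1 - x) / 2) by field.
  replace ((1 - x) / 2 + / 2) with (1 - x / 2) by field.
  replace (2 * (x / 2)) with x by field.
  replace (2 * ((1 - x) / 2)) with (1 - x) by field.
  intros D1 D2.
  replace (PI * x) with (2 * (PI * (x / 2))) by field.
  replace (PI * ((1 - x) / 2)) with (PI / 2 - PI * (x / 2)) by field.
  rewrite sin_2a, sin_shift. set (y := PI * (x / 2)).
  assert (Hy : 0 < y < PI / 2) by (unfold y; nra).
  assert (Hs : 0 < sin y) by (apply sin_gt_0; lra).
  assert (Hc : 0 < cos y) by (apply cos_gt_0; lra).
  assert (E : PI ^ 2 / (2 * sin y * cos y) ^ 2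
              = (PI ^ 2 / sin y ^ 2 + PI ^ 2 / cos y ^ 2) / 4).
  { replace ((PI ^ 2 / sin y ^ 2 + PI ^ 2 / cos y ^ 2) / 4)
      with (PI ^ 2 * ((sin y)² + (cos y)²) / (2 * sin y * cos y) ^ 2)
      by (unfold Rsqr; field; lra).
    rewrite sin2_cos2. field. lra. }
  rewrite E. lra.
Qed.

Lemma reflection_defect_le x : 0 < x <= 1 / 2 -> reflection_defect x <= PI ^ 2.
Proof.
  intros Hx. unfold reflection_defect. assert (Hpi := PI_RGT_0).
  generalize (inv_sin_sq_le (PI * x) ltac:(nra)). intros H.
  assert (Hp2 : 0 < PI ^ 2) by now apply pow_lt.
  apply Rmult_le_compat_l with (r := PI ^ 2) in H; [|lra].
  replace (PI ^ 2 * (/ (PI * x) ^ 2 + 1)) with (/ x ^ 2 + PI ^ 2) in H by (field; lra).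
  rewrite (trigamma_succ x) by lra.
  generalize (trigamma_pos (x + 1) ltac:(lra)) (trigamma_pos (1 - x) ltac:(lra)).
  unfold Rdiv. lra.
Qed.

(** Herglotz's trick: by the duplication formula any upper bound on [(0, 1/2]] can
    be halved, so the best one is at most [0]. *)
Lemma reflection_defect_npos x : 0 < x <= 1 / 2 -> reflection_defect x <= 0.
Proof.
  intros Hx.
  assert (H : forall n x, 0 < x <= 1 / 2 -> reflection_defect x <= PI ^ 2 * (/ 2) ^ n).
  { induction n as [|n IH]; intros z Hz.
    - rewrite pow_O, Rmult_1_r. now apply reflection_defect_le.
    - rewrite reflection_defect_duplication by lra.
      generalize (IH (z / 2) ltac:(lra)) (IH ((1 - z) / 2) ltac:(lra)).
      simpl. lra. }
  apply (is_lim_seq_le (fun _ => reflection_defect x) (fun n => PI ^ 2 * (/ 2) ^ n)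
           (reflection_defect x) 0).
  - intros n. now apply H.
  - apply is_lim_seq_const.
  - replace (Finite 0) with (Rbar_mult (PI ^ 2) 0) by (simpl; f_equal; ring).
    apply is_lim_seq_scal_l, is_lim_seq_geom. rewrite Rabs_pos_eq; lra.
Qed.

(** The nonpositive defect at [1/2] gives [2 * psi' (1/2) >= PI ^ 2]; duplication
    at [1/2] gives [psi' (1/2) = 3 * psi' 1]; and [psi' 1 = 1 + psi' 2]. *)
Lemma trigamma_2_ge : PI ^ 2 / 6 - 1 <= trigamma 2.
Proof.
  generalize (reflection_defect_npos (1 / 2) ltac:(lra)).
  unfold reflection_defect.
  replace (PI * (1 / 2)) with (PI / 2) by field. rewrite sin_PI2, pow1.
  replace (1 - 1 / 2) with (/ 2) by field.
  generalize (trigamma_duplication (/ 2) ltac:(lra)) (trigamma_succ 1 Rlt_0_1).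
  replace (/ 2 + / 2) with 1 by field. replace (2 * / 2) with 1 by field.
  replace (1 / 2) with (/ 2) by field.
  rewrite pow1, Rinv_1. replace (1 + 1) with 2 by ring. lra.
Qed.

(** * Monotonicity and convexity of the logarithmic root *)

(** Outside [(1, 2)] a convex function lies above its chord over [[1, 2]], which
    here is zero. *)
Lemma ln_Gamma_nonneg a : 0 < a -> a <= 1 \/ 2 <= a -> 0 <= ln_Gamma a.
Proof.
  intros Ha0 [Ha | Ha].
  - generalize (ln_Gamma_convex a 2 (/ (2 - a)) Ha0 ltac:(lra)).
    assert (Hi : 0 < / (2 - a) <= 1).
    { split; [apply Rinv_0_lt_compat; lra|].
      rewrite <- Rinv_1. apply Rinv_le_contravar; lra. }
    replace (/ (2 - a) * a + (1 - / (2 - a)) * 2) with 1 by (field; lra).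
    rewrite ln_Gamma_1, ln_Gamma_2. intros H.
    apply Rmult_le_reg_l with (/ (2 - a)); [lra|]. specialize (H ltac:(lra)). lra.
  - generalize (ln_Gamma_convex a 1 (/ (a - 1)) Ha0 ltac:(lra)).
    assert (Hi : 0 < / (a - 1) <= 1).
    { split; [apply Rinv_0_lt_compat; lra|].
      rewrite <- Rinv_1. apply Rinv_le_contravar; lra. }
    replace (/ (a - 1) * a + (1 - / (a - 1)) * 1) with 2 by (field; lra).
    rewrite ln_Gamma_1, ln_Gamma_2. intros H.
    apply Rmult_le_reg_l with (/ (a - 1)); [lra|]. specialize (H ltac:(lra)). lra.
Qed.

Definition log_root (a c x : R) : R := ln_Gamma (x + a) / x - c * ln (x + a).

(** This is [x ^ 2] times the derivative of [log_root a c], in a form that makes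
    sense at [x = 0]. *)
Definition log_root_slope (a c x : R) : R :=
  x * digamma_series (x + a) - ln_Gamma (x + a) - c * (x ^ 2 / (x + a)).

Lemma is_derive_log_root a c x : 0 < a -> 0 < x ->
  is_derive (log_root a c) x (log_root_slope a c x / x ^ 2).
Proof.
  intros Ha Hx. unfold log_root, log_root_slope.
  assert (H := is_derive_ln_Gamma (x + a) ltac:(lra)).
  auto_derive.
  - repeat split; try lra. eexists; exact H.
  - rewrite (is_derive_unique (fun u : R => ln_Gamma u) _ _ H). field. lra.
Qed.

Lemma is_derive_log_root_slope a c x : 0 < a -> 0 <= x ->
  is_derive (log_root_slope a c) x
    (x * (trigamma (x + a) - c * ((x + 2 * a) / (x + a) ^ 2))).
Proof.
  intros Ha Hx. unfold log_root_slope.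
  assert (H := is_derive_ln_Gamma (x + a) ltac:(lra)).
  assert (H' := is_derive_digamma_series (x + a) ltac:(lra)).
  auto_derive.
  - repeat split; try lra; eexists; eassumption.
  - rewrite (is_derive_unique (fun u : R => ln_Gamma u) _ _ H),
      (is_derive_unique (fun u : R => digamma_series u) _ _ H'). field. lra.
Qed.

Lemma log_root_slope_0 a c : 0 < a -> log_root_slope a c 0 = - ln_Gamma a.
Proof.
  intros Ha. unfold log_root_slope. rewrite Rplus_0_l. field. lra.
Qed.

(** The slope starts at [- ln (Gamma a) <= 0] and decreases: with [t = x + a],
    [psi' t < (t + 1) / t ^ 2 <= c * (t + a) / t ^ 2]. *)
Lemma log_root_slope_neg a c x : 2 <= a -> 1 <= c -> 0 < x ->
  log_root_slope a c x < 0.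
Proof.
  intros Ha Hc Hx.
  enough (- log_root_slope a c 0 < - log_root_slope a c x).
  { rewrite log_root_slope_0 in H by lra.
    generalize (ln_Gamma_nonneg a ltac:(lra) (or_intror Ha)). lra. }
  apply (increasing_of_derive_pos (fun x => - log_root_slope a c x)
    (fun x => - (x * (trigamma (x + a) - c * ((x + 2 * a) / (x + a) ^ 2)))));
    [exact Hx | |]; intros z Hz.
  - apply (is_derive_opp (log_root_slope a c)). apply is_derive_log_root_slope; lra.
  - set (t := z + a).
    assert (Ht : 2 < t) by (unfold t; lra).
    assert (HT := trigamma_lt t ltac:(lra)).
    assert (H2 : 0 < t ^ 2) by (apply pow_lt; lra).
    assert (E : 1 / t + 1 / t ^ 2 <= (z + 2 * a) / t ^ 2).
    { replace (1 / t + 1 / t ^ 2) with ((t + 1) / t ^ 2) by (field; lra).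
      apply Rmult_le_compat_r; [left; now apply Rinv_0_lt_compat | unfold t; lra]. }
    set (r := (z + 2 * a) / t ^ 2) in *.
    assert (Hr : 0 < r) by (apply Rdiv_lt_0_compat; [lra | exact H2]).
    assert (Hcr : 1 * r <= c * r) by (apply Rmult_le_compat_r; lra).
    replace (- _) with (z * (c * r - trigamma t)) by ring.
    apply Rmult_lt_0_compat; lra.
Qed.

(** The slope starts at [0], and its derivative has the sign of
    [t ^ 2 * psi' t - c * (t + 2)], where [t = x + 2].  That expression is
    nonnegative at [t = 2] by [trigamma_2_ge].  It increases, because its
    derivative exceeds [1 - 1 / (2 t ^ 2) - c >= 7 / 8 - c], and
    [c <= psi' 2 < 3 / 4]. *)
Lemma log_root_slope_pos c x : c <= PI ^ 2 / 6 - 1 -> 0 < x ->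
  0 < log_root_slope 2 c x.
Proof.
  intros Hc Hx.
  assert (H2 := trigamma_2_ge). assert (H2' := trigamma_lt 2 ltac:(lra)).
  replace 0 with (log_root_slope 2 c 0)
    by (rewrite log_root_slope_0, ln_Gamma_2; lra).
  apply (increasing_of_derive_pos (log_root_slope 2 c)
    (fun x => x * (trigamma (x + 2) - c * ((x + 2 * 2) / (x + 2) ^ 2))));
    [exact Hx | |]; intros z Hz.
  - apply is_derive_log_root_slope; lra.
  - apply Rmult_lt_0_compat; [lra|].
    set (t := z + 2). assert (Ht : 2 < t) by (unfold t; lra).
    replace (z + 2 * 2) with (t + 2) by (unfold t; ring).
    assert (Ht2 : 0 < t ^ 2) by (apply pow_lt; lra).
    enough (D : 0 < t ^ 2 * trigamma t - c * (t + 2)).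
    { apply Rmult_lt_reg_l with (t ^ 2); [exact Ht2|].
      replace (t ^ 2 * (trigamma t - c * ((t + 2) / t ^ 2)))
        with (t ^ 2 * trigamma t - c * (t + 2)) by (field; lra).
      lra. }
    apply Rle_lt_trans with (2 ^ 2 * trigamma 2 - c * (2 + 2)); [lra|].
    apply (increasing_of_derive_pos (fun t => t ^ 2 * trigamma t - c * (t + 2))
      (fun t => 2 * t * trigamma t - t ^ 2 * neg_tetragamma t - c));
      [exact Ht | |]; intros s Hs.
    + assert (H := is_derive_trigamma s ltac:(lra)). auto_derive.
      * eexists; exact H.
      * rewrite (is_derive_unique (fun u : R => trigamma u) _ _ H). ring.
    + assert (A1 := trigamma_gt s ltac:(lra)).
      assert (A2 := neg_tetragamma_lt s ltac:(lra)).
      assert (Hs2 : 0 < s ^ 2) by (apply pow_lt; lra).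
      apply Rmult_lt_compat_l with (r := 2 * s) in A1; [|lra].
      apply Rmult_lt_compat_l with (r := s ^ 2) in A2; [|exact Hs2].
      replace (2 * s * (1 / s + 1 / (2 * s ^ 2))) with (2 + 1 / s) in A1
        by (field; lra).
      replace (s ^ 2 * (1 / s ^ 2 + 1 / s ^ 3 + 1 / (2 * s ^ 4)))
        with (1 + 1 / s + 1 / (2 * s ^ 2)) in A2 by (field; lra).
      assert (1 / (2 * s ^ 2) <= 1 / 8).
      { apply Rmult_le_compat_l; [lra|]. apply Rinv_le_contravar; nra. }
      lra.
Qed.

(** The expression starts at [ln (Gamma a)], and its derivative is
    [x * (psi' t + x * psi'' t)] with [t = x + a].  Since [x <= t - 1/2], the
    bounds on [psi'] and [psi''] leave at least [1 / (4 t ^ 4)] in the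
    parentheses.  The condition [1/2 <= a] is sharp at infinity, where the
    parentheses are [(a - 1/2) / t ^ 2 + O(1 / t ^ 3)]. *)
Lemma convexity_numerator_pos a x : 1 / 2 <= a -> 0 <= ln_Gamma a -> 0 < x ->
  0 < x ^ 2 * trigamma (x + a) - x * digamma_series (x + a) + ln_Gamma (x + a).
Proof.
  intros Ha HG Hx.
  set (m := fun x => x ^ 2 * trigamma (x + a) - x * digamma_series (x + a) + ln_Gamma (x + a)).
  enough (m 0 < m x).
  { apply Rle_lt_trans with (2 := H). unfold m. rewrite Rplus_0_l. lra. }
  apply (increasing_of_derive_pos m
    (fun x => x * (trigamma (x + a) - x * neg_tetragamma (x + a))));
    [exact Hx | |]; intros z Hz; unfold m.
  - assert (H := is_derive_ln_Gamma (z + a) ltac:(lra)).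
    assert (H' := is_derive_digamma_series (z + a) ltac:(lra)).
    assert (H'' := is_derive_trigamma (z + a) ltac:(lra)).
    auto_derive.
    + repeat split; eexists; eassumption.
    + rewrite (is_derive_unique (fun u : R => ln_Gamma u) _ _ H),
        (is_derive_unique (fun u : R => digamma_series u) _ _ H'),
        (is_derive_unique (fun u : R => trigamma u) _ _ H''). ring.
  - apply Rmult_lt_0_compat; [lra|].
    set (t := z + a). assert (Ht : 1 / 2 < t) by (unfold t; lra).
    assert (Hz2 : z <= t - 1 / 2) by (unfold t; lra).
    assert (A1 := trigamma_gt t ltac:(lra)).
    assert (A2 := neg_tetragamma_lt t ltac:(lra)).
    set (q := 1 / t ^ 2 + 1 / t ^ 3 + 1 / (2 * t ^ 4)) in A2.
    assert (P : forall n, 0 < t ^ n) by (intros n; apply pow_lt; lra).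
    assert (P2 := P 2%nat). assert (P3 := P 3%nat). assert (P4 := P 4%nat).
    assert (Hq : 0 < q).
    { unfold q. repeat apply Rplus_lt_0_compat; apply Rdiv_lt_0_compat; lra. }
    assert (E : (t - 1 / 2) * q = 1 / t + 1 / (2 * t ^ 2) - 1 / (4 * t ^ 4))
      by (unfold q; field; lra).
    assert (0 < 1 / (4 * t ^ 4)) by (apply Rdiv_lt_0_compat; lra).
    assert (z * neg_tetragamma t <= z * q) by (apply Rmult_le_compat_l; lra).
    assert (z * q <= (t - 1 / 2) * q) by (apply Rmult_le_compat_r; lra).
    lra.
Qed.

(** This ratio is [x * log_root' x], the derivative of [log_root] with respect to
    [ln x]. *)
Lemma log_root_slope_ratio_increasing a c x y : c <= 0 ->
  1 / 2 <= a <= 1 \/ 2 <= a -> 0 < x -> x < y ->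
  log_root_slope a c x / x < log_root_slope a c y / y.
Proof.
  intros Hc Ha Hx Hxy.
  assert (Ha2 : 1 / 2 <= a) by (destruct Ha; lra).
  apply (increasing_of_derive_pos (fun x => log_root_slope a c x / x)
    (fun x => (x ^ 2 * trigamma (x + a) - x * digamma_series (x + a) + ln_Gamma (x + a))
              / x ^ 2 - c * (a / (x + a) ^ 2))); [exact Hxy | |]; intros z Hz.
  - assert (H := is_derive_log_root_slope a c z ltac:(lra) ltac:(lra)).
    auto_derive.
    + repeat split; try lra. eexists; exact H.
    + rewrite (is_derive_unique (fun u : R => log_root_slope a c u) _ _ H).
      unfold log_root_slope. field. lra.
  - assert (Hz2 : 0 < z ^ 2) by (apply pow_lt; lra).
    assert (Hza : 0 < (z + a) ^ 2) by (apply pow_lt; lra).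
    assert (M := convexity_numerator_pos a z Ha2
      (ln_Gamma_nonneg a ltac:(lra) ltac:(destruct Ha; lra)) ltac:(lra)).
    apply Rdiv_lt_0_compat with (2 := Hz2) in M.
    assert (0 < a / (z + a) ^ 2) by (apply Rdiv_lt_0_compat; lra).
    nra.
Qed.

(** Strict convexity in the variable [ln x] puts [log_root] above its tangent at
    [y]: the derivative of [log_root z - k * ln z], with [k] the tangent slope,
    changes sign exactly at [z = y]. *)
Lemma log_root_gt_tangent a c x y : c <= 0 ->
  1 / 2 <= a <= 1 \/ 2 <= a -> 0 < x -> 0 < y -> x <> y ->
  log_root_slope a c y / y * (ln x - ln y) < log_root a c x - log_root a c y.
Proof.
  intros Hc Ha Hx Hy Hne.
  assert (Ha2 : 1 / 2 <= a) by (destruct Ha; lra).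
  set (k := log_root_slope a c y / y).
  set (phi := fun z => log_root a c z - k * ln z).
  set (dphi := fun z => (log_root_slope a c z / z - k) / z).
  assert (Hd : forall z, 0 < z -> is_derive phi z (dphi z)).
  { intros z Hz. unfold phi, dphi.
    assert (H := is_derive_log_root a c z ltac:(lra) Hz).
    auto_derive.
    - repeat split; try lra. eexists; exact H.
    - rewrite (is_derive_unique (fun u : R => log_root a c u) _ _ H). field. lra. }
  enough (phi y < phi x) by (unfold phi in *; lra).
  destruct (Rlt_or_le x y) as [Hlt | Hle].
  - apply Ropp_lt_cancel.
    apply (increasing_of_derive_pos (fun z => - phi z) (fun z => - dphi z));
      [exact Hlt | |]; intros z Hz.
    + apply (is_derive_opp phi), Hd. lra.
    + assert (H := log_root_slope_ratio_increasing a c z y Hc Ha ltac:(lra) ltac:(lra)).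
      unfold dphi. replace (- _) with ((k - log_root_slope a c z / z) / z) by (field; lra).
      apply Rdiv_lt_0_compat; unfold k; lra.
  - apply (increasing_of_derive_pos phi dphi); [lra | |]; intros z Hz.
    + apply Hd. lra.
    + assert (H := log_root_slope_ratio_increasing a c y z Hc Ha ltac:(lra) ltac:(lra)).
      apply Rdiv_lt_0_compat; unfold k; lra.
Qed.

(** The exponent [c] is arbitrary: the terms in [c] cancel against those inside
    [log_root]. *)
Lemma Gamma_root_ratio a c x y :
  Rpower (Gamma (x + a)) (1 / x) / Rpower (Gamma (y + a)) (1 / y)
  = exp (log_root a c x - log_root a c y + c * (ln (x + a) - ln (y + a))).
Proof.
  unfold Rpower, Rdiv at 1. rewrite <- exp_Ropp, <- exp_plus. f_equal.
  unfold log_root, ln_Gamma, Rdiv. ring.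
Qed.

Lemma Rpower_div u v c : 0 < u -> 0 < v ->
  Rpower (u / v) c = exp (c * (ln u - ln v)).
Proof. intros Hu Hv. unfold Rpower. now rewrite ln_div. Qed.

Theorem corollary3 (a c : R) (ha : 0 < a) :
  (forall x y : R, 0 < x -> x < y ->
     (2 <= a -> 1 <= c ->
        Rpower (Gamma (x + a)) (1 / x) / Rpower (Gamma (y + a)) (1 / y)
          > Rpower ((x + a) / (y + a)) c)
     /\
     (a = 2 -> c <= PI ^ 2 / 6 - 1 ->
        Rpower (Gamma (x + a)) (1 / x) / Rpower (Gamma (y + a)) (1 / y)
          < Rpower ((x + a) / (y + a)) c))
  /\
  (c <= 0 -> (1 / 2 <= a <= 1 \/ 2 <= a) ->
   forall x y : R, 0 < x -> 0 < y ->
     let lower :=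
       Rpower (x / y)
         ((y * digamma (y + a) - ln (Gamma (y + a))) / y - c * y / (y + a))
       * Rpower ((x + a) / (y + a)) c in
     let middle :=
       Rpower (Gamma (x + a)) (1 / x) / Rpower (Gamma (y + a)) (1 / y) in
     let upper :=
       Rpower (x / y)
         ((x * digamma (x + a) - ln (Gamma (x + a))) / x - c * x / (x + a))
       * Rpower ((x + a) / (y + a)) c in
     (lower <= middle /\ middle <= upper)
     /\ (lower = middle <-> x = y)
     /\ (middle = upper <-> x = y)).
Proof.
  split.
  - intros x y Hx Hxy. rewrite (Gamma_root_ratio a c), Rpower_div by lra. split.
    + intros Ha Hc. apply Rlt_gt, exp_increasing.
      enough (- log_root a c x < - log_root a c y) by lra.
      apply (increasing_of_derive_pos (fun z => - log_root a c z)
        (fun z => - (log_root_slope a c z / z ^ 2))); [exact Hxy | |]; intros z Hz.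
      * apply (is_derive_opp (log_root a c)), is_derive_log_root; lra.
      * replace (- _) with (- log_root_slope a c z / z ^ 2) by (field; lra).
        assert (H := log_root_slope_neg a c z Ha Hc ltac:(lra)).
        apply Rdiv_lt_0_compat; [lra | apply pow_lt; lra].
    + intros -> Hc. apply exp_increasing.
      enough (log_root 2 c x < log_root 2 c y) by lra.
      apply (increasing_of_derive_pos (log_root 2 c)
        (fun z => log_root_slope 2 c z / z ^ 2)); [exact Hxy | |]; intros z Hz.
      * apply is_derive_log_root; lra.
      * apply Rdiv_lt_0_compat; [apply log_root_slope_pos; lra | apply pow_lt; lra].
  - intros Hc Ha x y Hx Hy lower middle upper.
    set (d := c * (ln (x + a) - ln (y + a))).
    (* The two bounds differ only in the point [z] whose tangent slope they use. *)
    assert (B : forall z, 0 < z ->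
      Rpower (x / y) ((z * digamma (z + a) - ln (Gamma (z + a))) / z - c * z / (z + a))
        * Rpower ((x + a) / (y + a)) c
      = exp (log_root_slope a c z / z * (ln x - ln y) + d)).
    { intros z Hz. rewrite !Rpower_div, <- exp_plus by lra.
      rewrite digamma_eq_series by lra.
      f_equal. unfold d, log_root_slope, ln_Gamma. field. lra. }
    assert (EM : middle = exp (log_root a c x - log_root a c y + d))
      by apply Gamma_root_ratio.
    assert (EL : lower = exp (log_root_slope a c y / y * (ln x - ln y) + d)) by now apply B.
    assert (EU : upper = exp (log_root_slope a c x / x * (ln x - ln y) + d)) by now apply B.
    destruct (Req_dec x y) as [<- | Hne].
    + assert (L : lower = middle) by (rewrite EL, EM; f_equal; ring).
      assert (U : middle = upper) by (rewrite EU, EM; f_equal; ring).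
      repeat split; auto; lra.
    + assert (L : lower < middle).
      { rewrite EL, EM. apply exp_increasing.
        generalize (log_root_gt_tangent a c x y Hc Ha Hx Hy Hne). lra. }
      assert (U : middle < upper).
      (* The upper bound is the tangent inequality at [x], evaluated at [y]. *)
      { rewrite EU, EM. apply exp_increasing.
        generalize (log_root_gt_tangent a c y x Hc Ha Hy Hx (not_eq_sym Hne)). lra. }
      repeat split; intros; lra.
Qed.
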